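(* Let $(X,Q,\pi)$ be a finite Markov chain with a mean $\theta\le\theta_a$, satisfying $CD_\theta(K,n)$ for some $K>0$ and $n\in(0,\infty)$. Then $$\mathrm{diam}(X,d_\Gamma)\le\pi\sqrt{\frac nK},$$ where on the right-hand side $\pi=3.14159\ldots$ is the circle constant.
   Context: A finite Markov chain $(X,Q,\pi)$ is always assumed irreducible and reversible: $X$ is a finite set, $Q:X\times X\to[0,1]$ satisfies $\sum_{y}Q(x,y)=1$ for all $x$ and is irreducible, $\pi\in(0,1]^X$ is the unique stationary probability measure, and $Q(x,y)\pi(x)=Q(y,x)\pi(y)$ for all $x,y$. For $f,g\in\mathbb{R}^X$ put $\langle f,g\rangle_\pi=\sum_{x}f(x)g(x)\pi(x)$, $\Delta f(x)=\sum_{y}(f(y)-f(x))Q(x,y)$, and $\Gamma f(x)=\frac12\sum_{y}(f(y)-f(x))^2Q(x,y)$. A mean is a function $\theta:[0,\infty)\times[0,\infty)\to[0,\infty)$ which is continuous, smooth on $(0,\infty)\times(0,\infty)$, symmetric, monotone ($\theta(r,s)\ge\theta(t,s)$ for $r\ge t$), homogeneous ($\theta(\lambda r,\lambda s)=\lambda\theta(r,s)$) and normalized ($\theta(1,1)=1$). The arithmetic mean is $\theta_a(r,s)=\frac{r+s}2$; $\theta\le\theta_a$ is meant pointwise. Set $I_\theta=(0,\infty)$ if $\theta(0,s)=0$ for all $s>0$, and $I_\theta=[0,\infty)$ if $\theta(0,s)>0$ for all $s>0$. Write $\partial_1\theta(r,s)=\frac{\partial}{\partial r}\theta(r,s)$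 (at boundary points $r=0$ or $s=0$, relevant only if $I_\theta=[0,\infty)$, this is the one-sided partial derivative, implicitly assumed to exist where it is used). For $\rho\in(I_\theta)^X$ define $\Delta_\rho f(x)=\sum_{y}2\,\partial_1\theta(\rho(x),\rho(y))(f(y)-f(x))Q(x,y)$, $2\Gamma_\rho(f,g)=\Delta_\rho(fg)-f\Delta_\rho g-g\Delta_\rho f$, $2\Gamma_{2,\rho}(f,g)=\Delta\Gamma_\rho(f,g)-\Gamma_\rho(f,\Delta g)-\Gamma_\rho(g,\Delta f)$, and $\Gamma_\rho f=\Gamma_\rho(f,f)$, $\Gamma_{2,\rho}f=\Gamma_{2,\rho}(f,f)$. $X$ satisfies $CD_\theta(K,n)$ if $\langle\rho,\Gamma_{2,\rho}f-\frac1n(\Delta f)^2-K\Gamma_\rho f\rangle_\pi\ge0$ for all $\rho\in(I_\theta)^X$ and all $f\in\mathbb{R}^X$. The distance $d_\Gamma$ is $d_\Gamma(x,y)=\sup\{f(y)-f(x): f\in\mathbb{R}^X,\ \|\Gamma f\|_\infty\le1\}$, and $\mathrm{diam}(X,d_\Gamma)=\max_{x,y\in X}d_\Gamma(x,y)$. *)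

(* Defs.v *)
From HB Require Import structures.
From mathcomp Require Import all_boot all_order all_algebra.
From mathcomp Require Import all_classical all_reals all_analysis.

Set Implicit Arguments.
Unset Strict Implicit.
Unset Printing Implicit Defensive.

Import Order.TTheory GRing.Theory Num.Theory numFieldNormedType.Exports.

Local Open Scope classical_set_scope.
Local Open Scope ring_scope.

Section MarkovChain.
Context {R : realType} {X : finType}.
Implicit Types (Q : X -> X -> R) (m f g : X -> R).

Definition stationary_probability Q m : Prop :=
  [/\ forall x, 0 <= m x, \sum_x m x = 1
    & forall y, \sum_x m x * Q x y = m y].

Record markov_chain Q m : Prop := MarkovChain {
  mc_range : forall x y, 0 <= Q x y <= 1 ;
  mc_sum1 : forall x, \sum_y Q x y = 1 ;
  mc_irreducible : forall x y, connect [rel u v | 0 < Q u v] x y ;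
  mc_pi_range : forall x, 0 < m x <= 1 ;
  mc_stationary : stationary_probability Q m ;
  mc_unique : forall m', stationary_probability Q m' -> m' =1 m ;
  mc_reversible : forall x y, Q x y * m x = Q y x * m y
}.

Definition inner m f g : R := \sum_x f x * g x * m x.

Definition laplacian Q f (x : X) : R := \sum_y (f y - f x) * Q x y.

Definition carre_du_champ Q f (x : X) : R :=
  2^-1 * \sum_y (f y - f x) ^+ 2 * Q x y.

Definition supnorm f : R := \big[Num.max/0]_x `|f x|.

Definition dist_Gamma Q (x y : X) : \bar R :=
  ereal_sup [set (f y - f x)%:E | f in
    [set f : X -> R | supnorm (carre_du_champ Q f) <= 1]].

Definition diam_Gamma Q : \bar R :=
  \big[maxe/-oo%E]_x \big[maxe/-oo%E]_y dist_Gamma Q x y.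

End MarkovChain.

Section Mean.
Context {R : realType}.
Implicit Types (h theta : R -> R -> R).

(* C^k on the open quadrant (0,oo)^2: all iterated partial derivatives of order
   at most k exist and are continuous there.  Only the values of h on that
   (open) quadrant matter. *)
Fixpoint Ck_quadrant (k : nat) h : Prop :=
  (forall r s : R, 0 < r -> 0 < s ->
     {for (r, s), continuous (fun p : R * R => h p.1 p.2)}) /\
  match k with
  | 0%N => True
  | k'.+1 =>
    [/\ forall r s : R, 0 < r -> 0 < s ->
          derivable (h ^~ s) r 1 /\ derivable (h r) s 1,
        Ck_quadrant k' (fun r s => derive1 (h ^~ s) r)
      & Ck_quadrant k' (fun r s => derive1 (h r) s)]
  end.

Definition smooth_quadrant h : Prop := forall k, Ck_quadrant k h.

(* A mean is a function on [0,oo)^2; the values of theta outside that set are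
   unconstrained and never used. *)
Record is_mean theta : Prop := IsMean {
  mean_ge0 : forall r s : R, 0 <= r -> 0 <= s -> 0 <= theta r s ;
  mean_continuous :
    {within [set p : R * R | 0 <= p.1 /\ 0 <= p.2],
      continuous (fun p : R * R => theta p.1 p.2)} ;
  mean_smooth : smooth_quadrant theta ;
  mean_sym : forall r s : R, 0 <= r -> 0 <= s -> theta r s = theta s r ;
  mean_monotone :
    forall r s t : R, 0 <= t -> t <= r -> 0 <= s -> theta t s <= theta r s ;
  mean_homogeneous : forall l r s : R, 0 < l -> 0 <= r -> 0 <= s ->
    theta (l * r) (l * s) = l * theta r s ;
  mean_normalized : theta 1 1 = 1
}.

Definition theta_a (r s : R) : R := (r + s) / 2.

(* For a mean, homogeneity and nonnegativity force either theta 0 s = 0 for all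
   s > 0 or theta 0 s > 0 for all s > 0, so the [else] branch is the latter. *)
Definition mean_interval theta : set R :=
  if `[< forall s : R, 0 < s -> theta 0 s = 0 >]
  then [set r | 0 < r] else [set r | 0 <= r].

(* Difference quotient of the first variable at the boundary point (0, s). *)
Definition boundary_quotient theta (s : R) : R -> R :=
  fun t => (theta t s - theta 0 s) / t.

Definition partial1 theta (r s : R) : R :=
  if 0 < r then derive1 (theta ^~ s) r
  else lim (boundary_quotient theta s t @[t --> 0^'+]).

(* The (finite) one-sided derivatives entering [partial1] exist; this is a
   condition only when 0 belongs to the interval of theta.  At (r, s) with
   r > 0, differentiability in r follows from smoothness if s > 0 and from
   homogeneity if s = 0. *)
Definition has_boundary_partial1 theta : Prop :=
  mean_interval theta 0 ->
  forall s : R, 0 <= s -> cvg (boundary_quotient theta s t @[t --> 0^'+]).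

End Mean.

Section CurvatureDimension.
Context {R : realType} {X : finType}.
Variables (Q : X -> X -> R) (m : X -> R) (theta : R -> R -> R).
Implicit Types (rho f g : X -> R).

Definition laplacian_rho rho f (x : X) : R :=
  \sum_y 2 * partial1 theta (rho x) (rho y) * (f y - f x) * Q x y.

Definition Gamma_rho rho f g (x : X) : R :=
  2^-1 * (laplacian_rho rho (f \* g) x
          - f x * laplacian_rho rho g x - g x * laplacian_rho rho f x).

Definition Gamma2_rho rho f g (x : X) : R :=
  2^-1 * (laplacian Q (Gamma_rho rho f g) x
          - Gamma_rho rho f (laplacian Q g) x
          - Gamma_rho rho g (laplacian Q f) x).

Definition CD (K n : R) : Prop :=
  forall rho f, (forall x, mean_interval theta (rho x)) ->
    0 <= inner m rho (fun x => Gamma2_rho rho f f x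
                               - n^-1 * (laplacian Q f x) ^+ 2
                               - K * Gamma_rho rho f f x).

End CurvatureDimension.

(* Main.v *)
Require Import Defs.
From HB Require Import structures.
From mathcomp Require Import all_boot all_order all_algebra.
From mathcomp Require Import all_classical all_reals all_analysis.
From mathcomp Require Import ring lra.
Import Order.TTheory GRing.Theory Num.Theory numFieldNormedType.Exports.
Local Open Scope ring_scope.

Set Implicit Arguments.
Unset Strict Implicit.
Unset Printing Implicit Defensive.

(** The curvature-dimension condition gives a gradient estimate for the heat
    flow P_t = exp (t Delta) that also controls its speed; integrating the
    speed over all times bounds the sup distance from f to its equilibrium, and
    the oscillation of f is at most twice that distance.

    Put A(rho, f) = <rho, Gamma_rho f>, the [energy]. By reversibility and
    Euler's identity for the 1-homogeneous function theta, it is half of the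
    sum of
    theta(rho x, rho y) (f y - f x)^2 Q(x,y) m(x) ([inner_Gamma_rho]). When rho
    follows the heat flow and f runs it backwards, A has derivative
    2 <rho, Gamma_{2,rho} f> ([energy_is_derive], [inner_Gamma2_rho]), so for a
    probability density rho and c = <rho, Delta P_t f>, which does not change
    along the interpolation P_s rho, P_{t-s} f, CD(K, n) and Jensen's
    inequality yield A' >= 2 K A + (2/n) c^2. Gronwall's argument, together
    with A(rho, f) <= <rho, Gamma f> (this is theta <= theta_a) and
    Gamma f <= 1, gives [energy_gradient_estimate]:

      e^{2Kt} A(rho, P_t f) + (e^{2Kt} - 1) c^2 / (n K) <= 1.

    It has two consequences.
    - Concentrating rho at a point x gives
      |Delta P_t f (x)| <= sqrt (n K / (e^{2Kt} - 1)) ([laplacian_heat_le]).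
      The integral of the right-hand side over t > 0 is (pi/2) sqrt (n/K),
      since the substitution v = sqrt (e^{2Kt} - 1) turns it into the integral
      of sqrt (n/K) / (1 + v^2). Hence P_t f stays within (pi/2) sqrt (n/K)
      of f ([heat_displacement_le]).
    - Taking rho = 1 shows that the differences of P_t f along edges, hence by
      irreducibility along all pairs, are O(e^{-Kt}) ([heat_pair_bound]).

    Therefore f y - f x is at most twice (pi/2) sqrt (n/K), plus a term that
    vanishes as t grows ([osc_le]). *)

(** * Calculus on the real line *)

Section Calculus.
Context {R : realType}.
Implicit Types (f g : R -> R) (t df dg : R).

Lemma is_derive_mul f g t df dg : is_derive t 1 f df -> is_derive t 1 g dg ->
  is_derive t 1 (fun s => f s * g s) (df * g t + f t * dg).
Proof.
move=> hf hg; apply: (is_derive_eq (is_deriveM hf hg)).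
by rewrite /GRing.scale /= addrC (mulrC (g t)).
Qed.

Lemma is_derive_scale (c : R) f t df : is_derive t 1 f df ->
  is_derive t 1 (fun s => c * f s) (c * df).
Proof. by move=> hf; exact: (is_deriveZ c hf). Qed.

Lemma is_derive_fsum (I : Type) (r : seq I) (h : I -> R -> R) (dh : I -> R) t :
  (forall i, is_derive t 1 (h i) (dh i)) ->
  is_derive t 1 (fun s => \sum_(i <- r) h i s) (\sum_(i <- r) dh i).
Proof.
move=> hd; elim: r => [|i r ih].
  rewrite big_nil; under eq_fun do rewrite big_nil.
  exact: is_derive_cst.
by rewrite big_cons; under eq_fun do rewrite big_cons; exact: is_deriveD.
Qed.

Lemma is_derive_reverse f (a t df : R) : is_derive (a - t) 1 f df ->
  is_derive t 1 (fun s => f (a - s)) (- df).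
Proof.
move=> hf.
have hg : is_derive t 1 (fun s => a - s) (-1).
  apply: (is_derive_eq (is_deriveB (is_derive_cst a t 1) (is_derive_id t 1))).
  by rewrite sub0r.
have := @is_derive1_comp _ f (fun s => a - s) t df (-1) hf hg.
by rewrite mulrN1.
Qed.

Lemma is_derive_continuous f t df : is_derive t 1 f df -> {for t, continuous f}.
Proof. by move=> [hf _]; apply/differentiable_continuous/derivable1_diffP. Qed.

Lemma is_derive_ge0_le f (df : R -> R) (a b : R) : a <= b ->
  (forall t, a <= t <= b -> is_derive t 1 f (df t)) ->
  (forall t, a <= t <= b -> 0 <= df t) -> f a <= f b.
Proof.
move=> ab hd h0; apply: (@ger0_derive1_ndecr _ f a b) => //.
- move=> t; rewrite in_itv /= => /andP[at_ tb].
  by have [] : is_derive t 1 f (df t) by apply: hd; rewrite !ltW.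
- move=> t; rewrite in_itv /= => /andP[at_ tb].
  have tab : a <= t <= b by rewrite !ltW.
  by have [_] := hd t tab; rewrite derive1E => ->; exact: h0.
- apply/continuous_in_subspaceT => t /set_mem /=; rewrite in_itv /= => tab.
  exact: is_derive_continuous (hd t tab).
Qed.

Lemma near_pos f t : {for t, continuous f} -> 0 < f t -> \near t, 0 < f t.
Proof.
by move=> cf ft; exact: (cvgr_gt (f t) cf).
Qed.

End Calculus.

(** * Derivatives of means *)

Section MeanTheory.
Context {R : realType} {theta : R -> R -> R}.
Hypothesis htheta : is_mean theta.

Lemma mean_partial1_is_derive (r s : R) : 0 < r -> 0 < s ->
  is_derive r 1 (theta ^~ s) (partial1 theta r s).
Proof.
move=> r0 s0; have [_ [h _ _]] := mean_smooth htheta 1%N.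
have [hd _] := h r s r0 s0.
by rewrite /partial1 r0 derive1E; exact: derivableP.
Qed.

Lemma mean_quotient (r s : R) : 0 < r -> 0 < s ->
  theta r s = s * theta (r / s) 1.
Proof.
move=> r0 s0; rewrite -(mean_homogeneous htheta) ?ler01 ?divr_ge0 ?ltW//.
by rewrite mulr1 mulrCA divff ?mulr1 // gt_eqF.
Qed.

(** Homogeneity writes theta(u, v) as v * theta(u / v, 1), so the chain rule for
    theta reduces to the one for the single-variable function theta(., 1). *)
Lemma mean_comp_is_derive_quotient (u v : R -> R) (t du dv : R) :
  is_derive t 1 u du -> is_derive t 1 v dv -> 0 < u t -> 0 < v t ->
  is_derive t 1 (fun s => theta (u s) (v s))
    (dv * theta (u t / v t) 1
     + partial1 theta (u t / v t) 1 * (du - u t / v t * dv)).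
Proof.
move=> hu hv u0 v0.
have vn0 : v t != 0 by rewrite gt_eqF.
apply: (@near_eq_is_derive _ _ _ (fun s => v s * theta (u s / v s) 1)).
  have hu0 := near_pos (is_derive_continuous hu) u0.
  have hv0 := near_pos (is_derive_continuous hv) v0.
  near=> s; rewrite -mean_quotient //; near: s; [exact: hu0|exact: hv0].
have hq := is_derive_mul hu (is_deriveV vn0 hv).
have hp : is_derive (u t / v t) 1 (theta ^~ 1) (partial1 theta (u t / v t) 1).
  by apply: mean_partial1_is_derive; rewrite ?divr_gt0.
have hc := @is_derive1_comp _ (theta ^~ 1) (fun s => u s / v s) t _ _ hp hq.
apply: (is_derive_eq (is_derive_mul hv hc)).
rewrite /GRing.scale /=; congr (_ + _); field.
Unshelve. all: by end_near. Qed.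

(** The chain rule above with u the identity and v constant. *)
Lemma mean_partial1_quotient (r s : R) : 0 < r -> 0 < s ->
  partial1 theta r s = partial1 theta (r / s) 1.
Proof.
move=> r0 s0; have [_ <-] := mean_partial1_is_derive r0 s0.
have [_ ->] := mean_comp_is_derive_quotient
  (is_derive_id r 1) (is_derive_cst s r 1) r0 s0.
by rewrite mul0r add0r mulr0 subr0 mulr1.
Qed.

(** The chain rule above with u constant and v the identity: by symmetry of
    theta, the derivative in the second variable is again a first partial
    derivative. *)
Lemma mean_partial1_swap (r s : R) : 0 < r -> 0 < s ->
  partial1 theta s r
  = theta (r / s) 1 - r / s * partial1 theta (r / s) 1.
Proof.
move=> r0 s0; have [_ <-] := mean_partial1_is_derive s0 r0.
have heq : \near s, theta r s = theta s r.
  near=> s'; have s'0 : 0 < s' by near: s'; exact: lt_nbhsr.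
  by rewrite (mean_sym htheta) // ltW.
have hd := mean_comp_is_derive_quotient
  (is_derive_cst r s 1) (is_derive_id s 1) r0 s0.
have [_ ->] : is_derive s 1 (theta ^~ r) _ := near_eq_is_derive heq hd.
by rewrite mul1r sub0r mulr1 mulrN (mulrC (partial1 _ _ _)).
Unshelve. all: by end_near. Qed.

(** The usual two-variable chain rule; symmetry of theta expresses its second
    partial derivative through the first. *)
Lemma mean_comp_is_derive (u v : R -> R) (t du dv : R) :
  is_derive t 1 u du -> is_derive t 1 v dv -> 0 < u t -> 0 < v t ->
  is_derive t 1 (fun s => theta (u s) (v s))
    (partial1 theta (u t) (v t) * du + partial1 theta (v t) (u t) * dv).
Proof.
move=> hu hv u0 v0.
apply: (is_derive_eq (mean_comp_is_derive_quotient hu hv u0 v0)).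
by rewrite (mean_partial1_quotient u0 v0) (mean_partial1_swap u0 v0); ring.
Qed.

(** Euler's identity for 1-homogeneous functions, in its symmetric form. *)
Lemma mean_euler (r s : R) : 0 < r -> 0 < s ->
  r * partial1 theta r s + s * partial1 theta s r = theta r s.
Proof.
move=> r0 s0; rewrite (mean_quotient r0 s0) (mean_partial1_swap r0 s0).
rewrite (mean_partial1_quotient r0 s0); field.
by rewrite gt_eqF.
Qed.

Lemma mean_interval_pos (r : R) : 0 < r -> mean_interval theta r.
Proof.
by move=> r0; rewrite /mean_interval; case: ifP => _ //=; exact: ltW.
Qed.

End MeanTheory.

(** * The heat flow of a stochastic matrix *)

Section HeatFlow.
Context {R : realType} {X : finType} (Q : X -> X -> R).
Hypothesis Q_ge0 : forall x y, 0 <= Q x y.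
Hypothesis Q_sum1 : forall x, \sum_y Q x y = 1.
Implicit Types (f g : X -> R) (x y : X) (t : R).

(** The Laplacian is averaging minus the identity, so exp (t Delta) is e^{-t}
    times the exponential series of the averaging operator; all terms of that
    series preserve positivity, which is not visible on exp (t Delta). *)
Definition averaging f x : R := \sum_y Q x y * f y.

Definition heat_coeff f x (k : nat) : R := k`!%:R^-1 * iter k averaging f x.

Definition heat f t x : R := expR (- t) * limn (pseries (heat_coeff f x) t).

Lemma laplacianE f x : laplacian Q f x = averaging f x - f x.
Proof.
rewrite /laplacian /averaging -[f x in RHS]mul1r -(Q_sum1 x) mulr_suml -sumrB.
by apply: eq_bigr => y _; ring.
Qed.

Lemma norm_averaging_le (M : R) f : (forall x, `|f x| <= M) ->
  forall x, `|averaging f x| <= M.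
Proof.
move=> hM x; apply: (le_trans (ler_norm_sum _ _ _)).
rewrite -[leRHS]mul1r -(Q_sum1 x) mulr_suml; apply: ler_sum => y _.
by rewrite normrM ger0_norm // ler_wpM2l.
Qed.

Lemma norm_iter_averaging_le (M : R) f k : (forall x, `|f x| <= M) ->
  forall x, `|iter k averaging f x| <= M.
Proof. by move=> hM; elim: k => // k ih; exact: norm_averaging_le. Qed.

Lemma iter_averaging_ge0 f k : (forall x, 0 <= f x) ->
  forall x, 0 <= iter k averaging f x.
Proof.
move=> f0; elim: k => //= k ih x.
by apply: sumr_ge0 => y _; rewrite mulr_ge0.
Qed.

(** Averaging does not increase the sup norm, so the series is dominated by a
    multiple of the exponential series. *)
Lemma heat_series_cvg f x t : cvgn (pseries (heat_coeff f x) t).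
Proof.
pose M := \sum_x `|f x|.
have hM z : `|f z| <= M by rewrite /M (bigD1 z) //= lerDl sumr_ge0.
apply: normed_cvg.
apply: (@series_le_cvg _ _ (fun k => M * exp_coeff `|t| k)) => [k|k|k|].
- exact: normr_ge0.
- by rewrite /= mulr_ge0 ?exp_coeff_ge0 // (le_trans _ (hM x)).
- have k0 : 0 <= k`!%:R^-1 :> R by rewrite invr_ge0.
  rewrite /heat_coeff /exp_coeff /= !normrM normrX (ger0_norm k0).
  rewrite mulrAC mulrC (mulrC _^-1) ler_wpM2r //.
  exact: norm_iter_averaging_le.
- exact: (@is_cvg_seriesZ _ _ M (is_cvg_series_exp_coeff `|t|)).
Qed.

(** Termwise differentiation shifts the coefficients, that is, applies one more
    averaging step to f. *)
Lemma pseries_diffs_heat_coeff f x :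
  pseries_diffs (heat_coeff f x) = heat_coeff (averaging f) x.
Proof.
apply/funext => k; rewrite /pseries_diffs /heat_coeff -iterSr factS natrM.
by rewrite invfM -mulrA mulVKf // pnatr_eq0.
Qed.

Lemma limn_averaging f x t :
  limn (pseries (heat_coeff (averaging f) x) t)
  = \sum_y Q x y * limn (pseries (heat_coeff f y) t).
Proof.
apply: cvg_lim => //.
have -> : pseries (heat_coeff (averaging f) x) t
    = fun n => \sum_y Q x y * pseries (heat_coeff f y) t n.
  apply/funext => n; rewrite /pseries /series /=.
  under [RHS]eq_bigr do rewrite mulr_sumr.
  rewrite exchange_big /=; apply: eq_bigr => k _.
  rewrite /heat_coeff -iterSr iterS /averaging mulr_sumr mulr_suml.
  by apply: eq_bigr => y _; ring.
apply: (cvg_big add_continuous) => y _.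
by apply: cvgM; [exact: cvg_cst|exact: heat_series_cvg].
Qed.

Lemma heat_is_derive f x t :
  is_derive t 1 (fun s => heat f s x) (laplacian Q (heat f t) x).
Proof.
have hp : is_derive t 1 (fun s => limn (pseries (heat_coeff f x) s))
    (limn (pseries (heat_coeff (averaging f) x) t)).
  rewrite -pseries_diffs_heat_coeff.
  apply: (@pseries_snd_diffs _ _ (`|t| + 1));
    rewrite ?pseries_diffs_heat_coeff; try exact: heat_series_cvg.
  by rewrite [ltRHS]ger0_norm ?addr_ge0 // ltrDl.
have he : is_derive t 1 (fun s : R => expR (- s)) (- expR (- t)).
  have hn := is_deriveNid t (1 : R).
  have := @is_derive1_comp _ (@expR R) -%R t _ _ (is_derive_expR (- t)) hn.
  by rewrite mulrN1.
apply: (is_derive_eq (is_derive_mul he hp)).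
rewrite laplacianE limn_averaging /heat /averaging mulr_sumr.
rewrite mulNr addrC; congr (_ - _); apply: eq_bigr => y _; ring.
Qed.

Lemma heat0 f x : heat f 0 x = f x.
Proof.
rewrite /heat oppr0 expR0 mul1r; apply: (@lim_near_cst R^o) => //.
near=> n; rewrite -[n]prednK; last by near: n.
rewrite /pseries /series /= big_nat_recl //= big1 ?addr0.
  by rewrite /heat_coeff fact0 invr1 expr0 mul1r mulr1.
by move=> k _; rewrite expr0n mulr0.
Unshelve. all: by end_near. Qed.

(** All terms of the series are nonnegative and the one of index 0 is f x. *)
Lemma heat_gt0 f t x : 0 <= t -> (forall y, 0 < f y) -> 0 < heat f t x.
Proof.
move=> t0 f0; rewrite /heat mulr_gt0 ?expR_gt0 //.
apply: (lt_le_trans (f0 x)).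
have -> : f x = pseries (heat_coeff f x) t 1%N.
  rewrite /pseries /series /= big_nat1 /heat_coeff fact0 invr1 expr0.
  by rewrite mul1r mulr1.
apply: nondecreasing_cvgn_le; last exact: heat_series_cvg.
apply/nondecreasing_seqP => n; rewrite /pseries /series /= big_nat_recr //=.
rewrite lerDl mulr_ge0 ?exprn_ge0 // mulr_ge0 //.
by apply: iter_averaging_ge0 => y; exact: ltW.
Qed.

Lemma laplacian_heat_is_derive f x t :
  is_derive t 1 (fun s => laplacian Q (heat f s) x)
    (laplacian Q (laplacian Q (heat f t)) x).
Proof.
apply: is_derive_fsum => y.
have hd : is_derive t 1 (fun s => heat f s y - heat f s x)
    (laplacian Q (heat f t) y - laplacian Q (heat f t) x).
  by apply: is_deriveB; exact: heat_is_derive.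
apply: (is_derive_eq (is_derive_mul hd (is_derive_cst (Q x y) t 1))).
by rewrite mulr0 addr0.
Qed.

End HeatFlow.

(** * The energy and its variation *)

(** The variance is nonnegative. *)
Lemma sqr_mean_le {R : realFieldType} {X : finType} (w g : X -> R) :
  (forall x, 0 <= w x) -> \sum_x w x = 1 ->
  (\sum_x w x * g x) ^+ 2 <= \sum_x w x * g x ^+ 2.
Proof.
move=> w0 w1.
have e c : \sum_x w x * (g x - c) ^+ 2
    = \sum_x w x * g x ^+ 2 - 2 * c * (\sum_x w x * g x) + c ^+ 2 * \sum_x w x.
  rewrite !mulr_sumr -sumrB -big_split /=.
  by apply: eq_bigr => x _; ring.
set c := \sum_x w x * g x.
have : 0 <= \sum_x w x * (g x - c) ^+ 2.
  by apply: sumr_ge0 => x _; rewrite mulr_ge0 ?sqr_ge0.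
by rewrite e w1 -/c; lra.
Qed.

Lemma mul_sqr_ge0 (R : realFieldType) (a d w : R) :
  0 <= a -> 0 <= w -> 0 <= a * d * d * w.
Proof.
by move=> a0 w0; rewrite -(mulrA a) -expr2 mulr_ge0 // mulr_ge0 // sqr_ge0.
Qed.

Section Energy.
Context {R : realType} {X : finType} (Q : X -> X -> R) (m : X -> R).
Context (theta : R -> R -> R).
Hypothesis hrev : forall x y, Q x y * m x = Q y x * m y.
Hypothesis htheta : is_mean theta.
Implicit Types (rho f g : X -> R) (x y : X) (t : R).

Lemma sum_reversible (H : X -> X -> R) :
  \sum_x \sum_y H y x * (Q x y * m x) = \sum_x \sum_y H x y * (Q x y * m x).
Proof.
rewrite exchange_big /=; apply: eq_bigr => x _; apply: eq_bigr => y _.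
by rewrite (hrev y x).
Qed.

Lemma inner_laplacian_sym f g :
  inner m f (laplacian Q g) = inner m (laplacian Q f) g.
Proof.
apply/eqP; rewrite -subr_eq0 /inner -sumrB; apply/eqP.
transitivity (\sum_x \sum_y f x * g y * (Q x y * m x)
              - \sum_x \sum_y f y * g x * (Q x y * m x)).
  rewrite -sumrB; apply: eq_bigr => x _; rewrite -sumrB /laplacian.
  rewrite mulr_sumr !mulr_suml -sumrB; apply: eq_bigr => y _; ring.
by rewrite (sum_reversible (fun x y => f x * g y)) subrr.
Qed.

Lemma sum_laplacian f : \sum_x laplacian Q f x * m x = 0.
Proof.
transitivity (inner m (laplacian Q f) (fun=> 1)).
  by apply: eq_bigr => x _; rewrite mulr1.
rewrite -inner_laplacian_sym /inner big1 // => x _.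
by rewrite /laplacian big1 ?mulr0 ?mul0r // => y _; rewrite subrr mul0r.
Qed.

Lemma Gamma_rhoE rho f g x : Gamma_rho Q theta rho f g x
  = \sum_y partial1 theta (rho x) (rho y) * (f y - f x) * (g y - g x) * Q x y.
Proof.
rewrite /Gamma_rho /laplacian_rho !mulr_sumr -!sumrB mulr_sumr.
by apply: eq_bigr => y _ /=; field.
Qed.

Definition energy rho f g : R :=
  2^-1 * \sum_x \sum_y
    theta (rho x) (rho y) * (f y - f x) * (g y - g x) * (Q x y * m x).

(** Averaging the summand over (x, y) and (y, x) produces the combination
    rho x * d1 theta(rho x, rho y) + rho y * d1 theta(rho y, rho x), which is
    theta(rho x, rho y) by Euler's identity. *)
Lemma inner_Gamma_rho rho f g : (forall x, 0 < rho x) ->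
  inner m rho (Gamma_rho Q theta rho f g) = energy rho f g.
Proof.
move=> rho0.
pose H x y := rho x * partial1 theta (rho x) (rho y)
              * (f y - f x) * (g y - g x).
have e : inner m rho (Gamma_rho Q theta rho f g)
    = \sum_x \sum_y H x y * (Q x y * m x).
  apply: eq_bigr => x _; rewrite Gamma_rhoE mulr_sumr mulr_suml.
  by apply: eq_bigr => y _; rewrite /H; ring.
suff : energy rho f g = 2^-1 * (\sum_x \sum_y H x y * (Q x y * m x)
    + \sum_x \sum_y H y x * (Q x y * m x)).
  by rewrite (sum_reversible H) -e => ->; field.
rewrite /energy -big_split /=; congr (_ * _); apply: eq_bigr => x _.
rewrite -big_split /=; apply: eq_bigr => y _.
by rewrite -(mean_euler htheta (rho0 x) (rho0 y)) /H; ring.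
Qed.

(** The right-hand side is the derivative of the energy when rho evolves by
    Delta rho and f by - Delta f, see [energy_is_derive]; this identifies the
    weak form of Gamma_2 with the second-order variation along the flow. *)
Lemma inner_Gamma2_rho rho f : (forall x, 0 < rho x) ->
  2 * inner m rho (Gamma2_rho Q theta rho f f)
  = inner m (laplacian Q rho) (Gamma_rho Q theta rho f f)
    - 2 * energy rho f (laplacian Q f).
Proof.
move=> rho0; rewrite -inner_laplacian_sym -inner_Gamma_rho //.
rewrite /inner !mulr_sumr -sumrB; apply: eq_bigr => x _.
by rewrite /Gamma2_rho; field.
Qed.

(** Differentiating theta(rho x, rho y) gives two terms exchanged by
    (x, y) -> (y, x); by reversibility they contribute equally, and half of
    their sum is the pairing of the derivative of rho with Gamma_rho. *)
Lemma energy_is_derive (rho u : R -> X -> R) (drho du : X -> R) t :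
  (forall x, is_derive t 1 (fun s => rho s x) (drho x)) ->
  (forall x, is_derive t 1 (fun s => u s x) (du x)) ->
  (forall x, 0 < rho t x) ->
  is_derive t 1 (fun s => energy (rho s) (u s) (u s))
    (inner m drho (Gamma_rho Q theta (rho t) (u t) (u t))
     + 2 * energy (rho t) (u t) du).
Proof.
move=> hrho hu rho0.
pose H x y := partial1 theta (rho t x) (rho t y) * drho x
              * (u t y - u t x) * (u t y - u t x).
pose D x y := (H x y + H y x + 2 * theta (rho t x) (rho t y)
               * (u t y - u t x) * (du y - du x)) * (Q x y * m x).
have hd x y : is_derive t 1 (fun s => theta (rho s x) (rho s y)
    * (u s y - u s x) * (u s y - u s x) * (Q x y * m x)) (D x y).
  have h1 := mean_comp_is_derive htheta (hrho x) (hrho y) (rho0 x) (rho0 y).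
  have h2 : is_derive t 1 (fun s => u s y - u s x) (du y - du x).
    exact: is_deriveB.
  have h3 := is_derive_mul (is_derive_mul h1 h2) h2.
  apply: (is_derive_eq (is_derive_mul h3 (is_derive_cst (Q x y * m x) t 1))).
  by rewrite /D /H mulr0 addr0 /cst /=; ring.
have hs := is_derive_fsum (index_enum X)
  (fun x => is_derive_fsum (index_enum X) (fun y => hd x y)).
apply: (is_derive_eq (is_derive_scale 2^-1 hs)).
have -> : inner m drho (Gamma_rho Q theta (rho t) (u t) (u t))
    = \sum_x \sum_y H x y * (Q x y * m x).
  apply: eq_bigr => x _; rewrite Gamma_rhoE mulr_sumr mulr_suml.
  by apply: eq_bigr => y _; rewrite /H; ring.
transitivity (2^-1 * (\sum_x \sum_y H x y * (Q x y * m x)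
    + \sum_x \sum_y H y x * (Q x y * m x)) + 2 * energy (rho t) (u t) du).
  rewrite /energy mulrA mulfV ?pnatr_eq0 // mul1r -big_split /=.
  rewrite !mulr_sumr -big_split /=; apply: eq_bigr => x _.
  rewrite -big_split /= !mulr_sumr -big_split /=; apply: eq_bigr => y _.
  by rewrite /D; field.
by rewrite (sum_reversible H); field.
Qed.

(** For the arithmetic mean the energy is exactly <rho, Gamma f>, and the energy
    is monotone in theta. *)
Lemma energy_le_carre_du_champ rho f :
  (forall x y, 0 <= Q x y) -> (forall x, 0 <= m x) ->
  (forall r s, 0 <= r -> 0 <= s -> theta r s <= theta_a r s) ->
  (forall x, 0 < rho x) ->
  energy rho f f <= inner m rho (carre_du_champ Q f).
Proof.
move=> Q0 m0 hle rho0.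
pose H x y := 2^-1 * rho x * (f y - f x) ^+ 2.
have e : inner m rho (carre_du_champ Q f)
    = \sum_x \sum_y H x y * (Q x y * m x).
  apply: eq_bigr => x _.
  rewrite /carre_du_champ !(mulr_sumr, mulr_suml).
  by apply: eq_bigr => y _; rewrite /H; ring.
have -> : inner m rho (carre_du_champ Q f) =
  2^-1 * (\sum_x \sum_y H x y * (Q x y * m x)
    + \sum_x \sum_y H y x * (Q x y * m x)).
  by rewrite (sum_reversible H) e; field.
rewrite /energy ler_wpM2l // -big_split /=; apply: ler_sum => x _.
rewrite -big_split /=; apply: ler_sum => y _.
rewrite -mulrDl ler_wpM2r ?mulr_ge0 //.
have := hle _ _ (ltW (rho0 x)) (ltW (rho0 y)).
move/(ler_wpM2r (sqr_ge0 (f y - f x))).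
rewrite -mulrA -expr2 => /le_trans; apply.
by rewrite le_eqVlt; apply/orP; left; apply/eqP; rewrite /theta_a /H; field.
Qed.

End Energy.

(** * The gradient estimate *)

Section CurvatureConsequences.
Context {R : realType} {X : finType} (Q : X -> X -> R) (m : X -> R).
Context (theta : R -> R -> R) (K n : R).
Hypothesis hX : markov_chain Q m.
Hypothesis htheta : is_mean theta.
Hypothesis hle : forall r s : R, 0 <= r -> 0 <= s -> theta r s <= theta_a r s.
Hypothesis hK : 0 < K.
Hypothesis hn : 0 < n.
Hypothesis hCD : CD Q m theta K n.
Implicit Types (rho f g : X -> R) (x y : X) (t : R).

Let Q_ge0 x y : 0 <= Q x y.
Proof. by case/andP: (mc_range hX x y). Qed.

Let m_gt0 x : 0 < m x.
Proof. by case/andP: (mc_pi_range hX x). Qed.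

Let Q_sum1 := mc_sum1 hX.
Let hrev := mc_reversible hX.
Let hd := heat_is_derive Q_ge0 Q_sum1.

Lemma heat_mass rho t : \sum_x heat Q rho t x * m x = \sum_x rho x * m x.
Proof.
transitivity (\sum_x heat Q rho 0 x * m x); last first.
  by apply: eq_bigr => x _; rewrite heat0.
apply: (@is_derive_0_is_cst _ (fun s => \sum_x heat Q rho s x * m x)) => s.
apply: (is_derive_eq (is_derive_fsum (index_enum X)
  (fun x => is_derive_mul (hd rho x s) (is_derive_cst (m x) s 1)))).
apply: etrans (sum_laplacian hrev (heat Q rho s)); apply: eq_bigr => x _.
by rewrite mulr0 addr0.
Qed.

(** Self-adjointness of the Laplacian makes the derivative in s vanish; thus the
    dimension term in the gradient estimate is the same at all s. *)
Lemma inner_heat_laplacian_heat rho f t s :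
  inner m (heat Q rho s) (laplacian Q (heat Q f (t - s)))
  = inner m rho (laplacian Q (heat Q f t)).
Proof.
pose F s := inner m (heat Q rho s) (laplacian Q (heat Q f (t - s))).
transitivity (F 0); last first.
  by rewrite /F subr0; apply: eq_bigr => x _; rewrite heat0.
apply: (@is_derive_0_is_cst _ F) => {}s.
have h x := is_derive_mul (is_derive_mul (hd rho x s) (is_derive_reverse
  (laplacian_heat_is_derive Q_ge0 Q_sum1 f x (t - s))))
  (is_derive_cst (m x) s 1).
apply: (is_derive_eq (is_derive_fsum (index_enum X) h)).
set u := heat Q f (t - s).
transitivity (inner m (laplacian Q (heat Q rho s)) (laplacian Q u)
              - inner m (heat Q rho s) (laplacian Q (laplacian Q u))).
  rewrite /inner -sumrB; apply: eq_bigr => x _.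
  by rewrite mulr0 addr0 /cst; ring.
by rewrite -(inner_laplacian_sym hrev) subrr.
Qed.

(** CD(K, n) tested on a positive probability density, with Jensen's inequality
    replacing <rho, (Delta f)^2> by <rho, Delta f>^2. *)
Lemma CD_energy rho f : (forall x, 0 < rho x) -> \sum_x rho x * m x = 1 ->
  2 * K * energy Q m theta rho f f
    + 2 / n * inner m rho (laplacian Q f) ^+ 2
  <= inner m (laplacian Q rho) (Gamma_rho Q theta rho f f)
     - 2 * energy Q m theta rho f (laplacian Q f).
Proof.
move=> rho0 rho1.
have := hCD f (fun x => mean_interval_pos (rho0 x)).
rewrite -(inner_Gamma2_rho hrev htheta) // -(inner_Gamma_rho hrev htheta) //.
have -> : inner m rho (fun x => Gamma2_rho Q theta rho f f x
      - n^-1 * laplacian Q f x ^+ 2 - K * Gamma_rho Q theta rho f f x)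
    = inner m rho (Gamma2_rho Q theta rho f f)
      - n^-1 * (\sum_x rho x * m x * laplacian Q f x ^+ 2)
      - K * inner m rho (Gamma_rho Q theta rho f f).
  rewrite /inner !mulr_sumr -!sumrB.
  by apply: eq_bigr => x _; ring.
have w0 x : 0 <= rho x * m x by rewrite mulr_ge0 // ltW.
have := sqr_mean_le (laplacian Q f) w0 rho1.
have -> : \sum_x rho x * m x * laplacian Q f x = inner m rho (laplacian Q f).
  by apply: eq_bigr => x _; ring.
have n0 : 0 <= n^-1 by rewrite invr_ge0 ltW.
move/(ler_wpM2l n0).
set a := inner _ _ _; set b := \sum_x _; set c := inner _ _ _.
set d := inner _ _ _; lra.
Qed.

(** Gronwall's argument: with k = c^2 / (n K), the function
    s |-> e^{-2Ks} (A(P_s rho, P_{t-s} f) + k) is nondecreasing on [0, t]. *)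
Lemma energy_gradient_estimate rho f t : 0 <= t ->
  (forall x, 0 < rho x) -> \sum_x rho x * m x = 1 ->
  (forall x, carre_du_champ Q f x <= 1) ->
  expR (2 * K * t) * energy Q m theta rho (heat Q f t) (heat Q f t)
  + (expR (2 * K * t) - 1)
    * (inner m rho (laplacian Q (heat Q f t)) ^+ 2 / (n * K)) <= 1.
Proof.
move=> t0 rho0 rho1 f1.
set c := inner m rho _.
set k := c ^+ 2 / (n * K).
pose E s :=
  energy Q m theta (heat Q rho s) (heat Q f (t - s)) (heat Q f (t - s)).
pose F s := expR (- (2 * K * s)) * (E s + k).
pose dE s := inner m (laplacian Q (heat Q rho s)) (Gamma_rho Q theta
      (heat Q rho s) (heat Q f (t - s)) (heat Q f (t - s)))
    - 2 * energy Q m theta (heat Q rho s) (heat Q f (t - s))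
        (laplacian Q (heat Q f (t - s))).
pose dF s := expR (- (2 * K * s)) * (dE s - 2 * K * (E s + k)).
have rhos0 s x : 0 <= s -> 0 < heat Q rho s x.
  by move=> s0; exact: heat_gt0.
have hF s : 0 <= s <= t -> is_derive s 1 F (dF s).
  case/andP=> s0 st.
  have hE : is_derive s 1 E (dE s).
    pose du x := - laplacian Q (heat Q f (t - s)) x.
    have hu x : is_derive s 1 (fun s => heat Q f (t - s) x) (du x).
      exact: is_derive_reverse (hd f x (t - s)).
    have rs x := rhos0 s x s0.
    have h := @energy_is_derive _ _ _ _ _ hrev htheta (heat Q rho)
      (fun s => heat Q f (t - s)) _ _ s (fun x => hd rho x s) hu rs.
    apply: (is_derive_eq h); rewrite /dE; congr (_ + _).
    rewrite -mulrN; congr (_ * _).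
    rewrite /energy -mulrN -sumrN; congr (_ * _); apply: eq_bigr => x _.
    by rewrite -sumrN; apply: eq_bigr => y _; rewrite /du; ring.
  have he : is_derive s 1 (fun s : R => expR (- (2 * K * s)))
      (expR (- (2 * K * s)) * - (2 * K)).
    have hl : is_derive s 1 (fun s : R => - (2 * K * s)) (- (2 * K)).
      have := is_deriveN (is_derive_scale (2 * K) (is_derive_id s (1 : R))).
      by rewrite mulr1.
    exact: (@is_derive1_comp _ (@expR R) (fun s => - (2 * K * s)) s _ _ _ hl).
  have hEk : is_derive s 1 (fun s => E s + k) (dE s).
    apply: (is_derive_eq (is_deriveD hE (is_derive_cst k s 1))).
    by rewrite addr0.
  apply: (is_derive_eq (is_derive_mul he hEk)).
  by rewrite /dF; ring.
have dF0 s : 0 <= s <= t -> 0 <= dF s.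
  case/andP=> s0 st; rewrite /dF mulr_ge0 ?expR_ge0 // subr_ge0.
  have rs x := rhos0 s x s0.
  have ms : \sum_x heat Q rho s x * m x = 1 by rewrite heat_mass.
  apply: le_trans (CD_energy (heat Q f (t - s)) rs ms).
  rewrite inner_heat_laplacian_heat -/(E s) -/c mulrDr lerD2l /k.
  rewrite le_eqVlt; apply/orP; left; apply/eqP; field.
  by rewrite !gt_eqF.
have := is_derive_ge0_le t0 hF dF0.
have E0 : E 0 = energy Q m theta rho (heat Q f t) (heat Q f t).
  rewrite /E subr0; suff -> : heat Q rho 0 = rho by [].
  by apply/funext => x; rewrite heat0.
have Et : E t <= 1.
  rewrite /E subrr; have -> : heat Q f 0 = f.
    by apply/funext => x; rewrite heat0.
  have rt x := rhos0 t x t0.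
  have m0 x : 0 <= m x by exact: ltW.
  apply: (le_trans (energy_le_carre_du_champ hrev f Q_ge0 m0 hle rt)).
  rewrite -[leRHS]rho1 -(heat_mass rho t); apply: ler_sum => x _.
  by rewrite ler_wpM2r // ler_piMr // ltW.
rewrite /F mulr0 oppr0 expR0 mul1r E0 expRN.
set e := expR _; set A := energy _ _ _ _ _ _.
have e0 : 0 < e by exact: expR_gt0.
rewrite mulrC ler_pdivlMr // => h.
have -> : e * A + (e - 1) * k = (A + k) * e - k by ring.
by rewrite lerBlDr; apply: (le_trans h); rewrite lerD2r.
Qed.

(** * The diameter bound *)

Variable f : X -> R.
Hypothesis hf : forall x, carre_du_champ Q f x <= 1.

Let m_sum1 : \sum_x m x = 1.
Proof. by case: (mc_stationary hX). Qed.

Let expR_ge1 t : 0 <= t -> 1 <= expR (2 * K * t).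
Proof.
move=> t0; apply: le_trans (expR_ge1Dx _).
by rewrite lerDl !mulr_ge0 // ltW.
Qed.

Lemma inner_laplacian_heat_le rho t : 0 <= t ->
  (forall x, 0 < rho x) -> \sum_x rho x * m x = 1 ->
  (expR (2 * K * t) - 1) * inner m rho (laplacian Q (heat Q f t)) ^+ 2
    <= n * K.
Proof.
move=> t0 rho0 rho1; have := energy_gradient_estimate t0 rho0 rho1 hf.
have E0 : 0 <= energy Q m theta rho (heat Q f t) (heat Q f t).
  rewrite /energy mulr_ge0 //; apply: sumr_ge0 => x _; apply: sumr_ge0 => y _.
  apply: mul_sqr_ge0; first by apply: (mean_ge0 htheta); exact: ltW.
  by rewrite mulr_ge0 // ltW.
have nK0 : 0 < n * K by rewrite mulr_gt0.
set c := inner _ _ _ => h.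
have : (expR (2 * K * t) - 1) * (c ^+ 2 / (n * K)) <= 1.
  by apply: le_trans h; rewrite lerDr mulr_ge0 // expR_ge0.
by rewrite mulrA ler_pdivrMr // mul1r.
Qed.

(** The previous bound applied to the densities
    rho = e + (1 - e) * delta_x / m x as e tends to 0. Since Delta P_t f has
    mean zero, <rho, Delta P_t f> is exactly (1 - e) * Delta P_t f (x). *)
Lemma laplacian_heat_le x t : 0 <= t ->
  (expR (2 * K * t) - 1) * laplacian Q (heat Q f t) x ^+ 2 <= n * K.
Proof.
move=> t0; set G := laplacian Q (heat Q f t).
set N := expR _ - 1.
have N0 : 0 <= N by rewrite subr_ge0 expR_ge1.
have nK0 : 0 < n * K by rewrite mulr_gt0.
have key e : 0 < e -> e < 1 -> N * ((1 - e) * G x) ^+ 2 <= n * K.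
  move=> e0 e1.
  pose rho y := e + (1 - e) * ((y == x)%:R / m x).
  have rho0 y : 0 < rho y.
    rewrite /rho ltr_pwDl // mulr_ge0 ?subr_ge0 ?(ltW e1) //.
    by rewrite divr_ge0 // ltW.
  have hrho (g : X -> R) :
      \sum_y rho y * g y * m y = e * (\sum_y g y * m y) + (1 - e) * g x.
    have -> : (1 - e) * g x
        = \sum_y (1 - e) * ((y == x)%:R / m x * g y * m y).
      rewrite (bigD1 x) //= big1 => [|y /negbTE ->].
        by rewrite eqxx addr0 mulr1n; field; rewrite gt_eqF.
      by rewrite !mul0r mulr0.
    rewrite mulr_sumr -big_split /=; apply: eq_bigr => y _; rewrite /rho; ring.
  have rho1 : \sum_y rho y * m y = 1.
    have := hrho (fun=> 1); under eq_bigr do rewrite mulr1.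
    move=> ->; under eq_bigr do rewrite mul1r.
    by rewrite m_sum1; ring.
  have := inner_laplacian_heat_le t0 rho0 rho1.
  by rewrite /inner hrho (sum_laplacian hrev) mulr0 add0r.
have [//|hlt] := leP (N * G x ^+ 2) (n * K).
set V := N * G x ^+ 2 in hlt *.
have V0 : 0 < V by exact: lt_trans hlt.
(* If V > n K, any e with 2 e V < V - n K contradicts key, because
   (1 - e)^2 >= 1 - 2 e. *)
pose e := (V - n * K) / (4 * V).
have e0 : 0 < e by rewrite divr_gt0 ?subr_gt0 // mulr_gt0.
have eV : 4 * V * e = V - n * K by rewrite /e; field; rewrite gt_eqF.
have e1 : e < 1.
  have V4 : 0 < 4 * V by rewrite mulr_gt0.
  by rewrite -(ltr_pM2l V4) eV mulr1; lra.
have := key e e0 e1.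
have -> : N * ((1 - e) * G x) ^+ 2 = (1 - 2 * e + e ^+ 2) * V.
  by rewrite /V; ring.
have : 0 <= e ^+ 2 * V by rewrite mulr_ge0 ?sqr_ge0 // ltW.
move=> h1 h2; exfalso.
have h3 : (1 - 2 * e) * V <= n * K.
  by apply: le_trans h2; rewrite [leRHS]mulrDl lerDl.
nra.
Qed.

(** With rho = 1 the weights theta(rho x, rho y) all equal 1, and the energy is
    a sum of nonnegative terms, one of which is a positive multiple of the
    square of this difference. *)
Lemma heat_edge_bound x y : 0 < Q x y -> exists2 C, 0 <= C &
  forall t, 0 <= t -> expR (K * t) * `|heat Q f t y - heat Q f t x| <= C.
Proof.
move=> Qxy; have w0 : 0 < Q x y * m x by rewrite mulr_gt0.
(* The gradient estimate bounds the square of the left-hand side by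
   D = 2 / (Q x y * m x); 1 + D avoids a square root, as a <= 1 + a ^+ 2. *)
exists (1 + 2 / (Q x y * m x)) => [|t t0].
  by rewrite addr_ge0 // divr_ge0 // ltW.
have r1 : \sum_z 1 * m z = 1 by under eq_bigr do rewrite mul1r.
have := energy_gradient_estimate t0 (fun=> ltr01) r1 hf.
set u := heat Q f t; set N := expR _; set c := inner _ _ _ => h.
have nK0 : 0 < n * K by rewrite mulr_gt0.
have N1 : 1 <= N by exact: expR_ge1.
have h1 : N * energy Q m theta (fun=> 1) u u <= 1.
  apply: le_trans h; rewrite lerDl mulr_ge0 ?subr_ge0 //.
  by rewrite divr_ge0 ?sqr_ge0 // ltW.
have h2 : 2^-1 * ((u y - u x) ^+ 2 * (Q x y * m x))
    <= energy Q m theta (fun=> 1) u u.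
  rewrite /energy ler_wpM2l // (bigD1 x) //= (bigD1 y) //=.
  have p z z' : 0 <= theta 1 1 * (u z - u z') * (u z - u z') * (Q z' z * m z').
    apply: mul_sqr_ge0; first by rewrite (mean_normalized htheta).
    by rewrite mulr_ge0 // ltW.
  rewrite (mean_normalized htheta) mul1r -expr2 -addrA lerDl addr_ge0 //.
    by apply: sumr_ge0 => z _; rewrite -(mean_normalized htheta).
  apply: sumr_ge0 => z _; apply: sumr_ge0 => z' _.
  by rewrite -(mean_normalized htheta).
have h3 : N * (2^-1 * ((u y - u x) ^+ 2 * (Q x y * m x))) <= 1.
  by apply: le_trans h1; rewrite ler_wpM2l // (le_trans ler01).
set a := expR _ * _.
have a2 : a ^+ 2 <= 2 / (Q x y * m x).
  rewrite ler_pdivlMr // /a exprMn real_normK ?num_real //.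
  have -> : expR (K * t) ^+ 2 = N.
    by rewrite expr2 -expRD /N; congr expR; ring.
  by move: h3; lra.
move: a2; set D := 2 / _ => a2.
have : 0 <= (a - 1) ^+ 2 by exact: sqr_ge0.
have D0 : 0 <= D by apply: le_trans a2; exact: sqr_ge0.
by rewrite sqrrB1 => hs; nra.
Qed.

(** Irreducibility joins any two points by a path of edges; chain the edge
    bounds by the triangle inequality. *)
Lemma heat_pair_bound x y : exists2 C, 0 <= C &
  forall t, 0 <= t -> expR (K * t) * `|heat Q f t y - heat Q f t x| <= C.
Proof.
have /connectP [p hp ->] := mc_irreducible hX x y.
elim: p x hp => [|z p ih] x /=.
  by move=> _; exists 0 => // t _; rewrite subrr normr0 mulr0.
case/andP=> /heat_edge_bound [C C0 hC] /ih [D D0 hD].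
exists (C + D) => [|t t0]; first exact: addr_ge0.
set u := heat Q f t.
apply: le_trans (lerD (hC t t0) (hD t t0)).
rewrite -mulrDr ler_wpM2l ?expR_ge0 //.
have -> : u (last z p) - u x = (u z - u x) + (u (last z p) - u z) by ring.
exact: ler_normD.
Qed.

(** Run the flow in the time tau v = ln (1 + v^2) / (2 K), for which
    e^{2 K tau v} - 1 = v^2. This is smooth at v = 0, and the bound on
    Delta P_t f says that the speed in v is at most sqrt (n/K) times the
    derivative of atan. The sign s covers both directions at once. *)
Lemma heat_displacement_le (s : R) x t : `|s| <= 1 -> 0 <= t ->
  s * (f x - heat Q f t x) <= Num.sqrt (n / K) * (pi / 2).
Proof.
move=> s1 t0; set c := Num.sqrt (n / K).
have c0 : 0 <= c by exact: sqrtr_ge0.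
have c2 : c ^+ 2 = n / K by rewrite sqr_sqrtr // divr_ge0 // ltW.
pose tau (v : R) := ln (1 + v ^+ 2) / (2 * K).
have p0 (v : R) : 0 < 1 + v ^+ 2 by rewrite ltr_wpDr ?sqr_ge0.
have tau0 v : 0 <= tau v.
  apply: divr_ge0; last by rewrite mulr_ge0 // ltW.
  by apply: ln_ge0; rewrite lerDl sqr_ge0.
have expRtau v : expR (2 * K * tau v) = 1 + v ^+ 2.
  rewrite /tau mulrC divfK ?lnK // ?posrE //.
  by rewrite mulf_neq0 // gt_eqF.
have htau (v : R) : is_derive v 1 tau ((1 + v ^+ 2)^-1 * (2 * v) / (2 * K)).
  have h1 : is_derive v 1 (fun v : R => 1 + v ^+ 2) (2 * v).
    have h := is_derive_mul (is_derive_id v (1 : R)) (is_derive_id v (1 : R)).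
    apply: (is_derive_eq (is_deriveD (is_derive_cst (1 : R) v (1 : R)) h)).
    by rewrite /=; ring.
  have h2 := @is_derive1_comp _ (@ln R) (fun v => 1 + v ^+ 2) v _ _
    (is_derive1_ln (p0 v)) h1.
  apply: (is_derive_eq (is_derive_mul h2 (is_derive_cst (2 * K)^-1 v (1 : R)))).
  by rewrite mulr0 addr0.
pose G (v : R) := laplacian Q (heat Q f (tau v)) x.
have hG (v : R) : `|v * G v| <= c * K.
  rewrite -ler_sqr ?nnegrE ?mulr_ge0 //; last exact: ltW.
  rewrite real_normK ?num_real // !exprMn c2.
  have := laplacian_heat_le x (tau0 v).
  rewrite expRtau addrAC subrr add0r => /le_trans; apply.
  by rewrite le_eqVlt; apply/orP; left; apply/eqP; field; rewrite gt_eqF.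
pose F (v : R) := c * atan v + s * heat Q f (tau v) x.
pose dF (v : R) := (1 + v ^+ 2)^-1 * (c + s * (v * G v) / K).
have hF (v : R) : is_derive v 1 F (dF v).
  have h1 := @is_derive1_comp _ (fun t => heat Q f t x) tau v _ _
    (heat_is_derive Q_ge0 Q_sum1 f x (tau v)) (htau v).
  apply: (is_derive_eq (is_deriveD (is_derive_scale c (is_derive1_atan v))
    (is_derive_scale s h1))).
  rewrite -/(G v) /dF; field.
  by rewrite !gt_eqF.
have dF0 (v : R) : 0 <= dF v.
  rewrite /dF mulr_ge0 ?invr_ge0 ?(ltW (p0 v)) //.
  have : `|s * (v * G v) / K| <= c.
    rewrite normrM normfV (gtr0_norm hK) ler_pdivrMr // normrM.
    by apply: le_trans (hG v); rewrite ler_piMl.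
  by rewrite ler_norml => /andP[h _]; rewrite -lerBlDl sub0r.
pose U := Num.sqrt (expR (2 * K * t) - 1).
have U0 : 0 <= U by exact: sqrtr_ge0.
have tauU : tau U = t.
  rewrite /tau sqr_sqrtr ?subr_ge0 ?expR_ge1 // addrC subrK expRK.
  by field; rewrite gt_eqF.
have := @is_derive_ge0_le _ F dF 0 U U0 (fun v _ => hF v) (fun v _ => dF0 v).
rewrite /F tauU atan0 mulr0 add0r.
have -> : tau 0 = 0 by rewrite /tau expr0n /= addr0 ln1 mul0r.
rewrite heat0 mulrBr lerBlDr => /le_trans; apply.
by rewrite lerD2r ler_wpM2l // ltW // atan_ltpi2.
Qed.

Lemma osc_le x y : f y - f x <= pi * Num.sqrt (n / K).
Proof.
have [C C0 hC] := heat_pair_bound x y.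
apply/ler_addgt0Pr => e e0.
(* Since e^{Kt} >= 1 + K t, this time makes C e^{-Kt} at most e. *)
pose t := C / (e * K).
have t0 : 0 <= t by rewrite divr_ge0 // mulr_ge0 // ltW.
have h1 : (f y - heat Q f t y) <= Num.sqrt (n / K) * (pi / 2).
  by have := heat_displacement_le (s := 1) y _ t0; rewrite mul1r normr1; apply.
have h2 : (heat Q f t x - f x) <= Num.sqrt (n / K) * (pi / 2).
  have := heat_displacement_le (s := -1) x _ t0.
  by rewrite mulN1r opprB normrN1; apply.
set d := `|heat Q f t y - heat Q f t x|.
have h3 : d <= e.
  have hCd : (1 + C / e) * d <= C.
    apply: le_trans (hC t t0); rewrite ler_wpM2r ?normr_ge0 //.
    have -> : C / e = K * t by rewrite /t; field; rewrite !gt_eqF.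
    exact: expR_ge1Dx.
  rewrite -(ler_pM2l (_ : 0 < 1 + C / e)); last first.
    by rewrite ltr_pwDl // divr_ge0 // ltW.
  apply: (le_trans hCd); rewrite mulrDl mul1r divfK ?gt_eqF //.
  by rewrite lerDr ltW.
have h4 : heat Q f t y - heat Q f t x <= e by exact: le_trans (ler_norm _) h3.
lra.
Qed.

End CurvatureConsequences.

Theorem theorem1p7 (R : realType) (X : finType)
    (Q : X -> X -> R) (m : X -> R) (theta : R -> R -> R) (K n : R)
    (hX : markov_chain Q m)
    (htheta : is_mean theta)
    (hpartial : has_boundary_partial1 theta)
    (hle : forall r s : R, 0 <= r -> 0 <= s ->
             theta r s <= theta_a r s)
    (hK : 0 < K) (hn : 0 < n)
    (hCD : CD Q m theta K n) :
  (diam_Gamma Q <= (pi * Num.sqrt (n / K))%:E)%E.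
Proof.
apply: bigmax_le; first exact: leNye.
move=> x _; apply: bigmax_le; first exact: leNye.
move=> y _; apply: ge_ereal_sup => _ [f hf <-].
rewrite lee_fin; apply: (osc_le hX htheta hle hK hn hCD) => z.
apply: (le_trans (ler_norm _)); apply: le_trans hf.
exact: (le_bigmax _ (fun z => `|carre_du_champ Q f z|) z).
Qed.
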